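(* Let $k$ be a positive integer, let $\{a_n\}_{n\in\mathbb{N}}$ be a non-zero sequence of complex numbers with $a_{n+k}=a_n$ for all $n\in\mathbb{N}$, and let $x_0,x_1\in\mathbb{C}$. Let $(x_n)_{n\ge0}$ be the solution of $$x_{n+2}=a_nx_{n+1}+x_n,\qquad n=0,1,2,\ldots,$$ with initial conditions $x_0,x_1$. Let $C_k=A_{k-1}A_{k-2}\cdots A_0$ with $A_i=\begin{bmatrix}a_i&1\\1&0\end{bmatrix}$, and let $C_k=J\Lambda J^{-1}$ be its Jordan decomposition with $J\in\mathbb{C}^{2\times 2}$ invertible and $\Lambda$ of the form specified in each case below. Write $J_{ij}$ and $J^{-1}_{ij}$ for the $(i,j)$ entries of the matrices $J$ and $J^{-1}$. Then for all $n=0,1,2,\ldots$ the following holds. 1. Case $k$ odd, or $k$ even and $|\operatorname{tr}C_k|\ne2$, with $\Lambda=\begin{bmatrix}\Phi_k^-&0\\0&\Phi_k^+\end{bmatrix}$: $$x_{nk}=J_{21}\left(J^{-1}_{11}x_1+J^{-1}_{12}x_0\right)(\Phi_k^-)^n+J_{22}\left(J^{-1}_{21}x_1+J^{-1}_{22}x_0\right)(\Phi_k^+)^n,$$ $$x_{nk+1}=J_{11}\left(J^{-1}_{11}x_1+J^{-1}_{12}x_0\right)(\Phi_k^-)^n+J_{12}\left(J^{-1}_{21}x_1+J^{-1}_{22}x_0\right)(\Phi_k^+)^n.$$ 2. Case $k$ even and $\operatorname{tr}C_k=2$, with $\Lambda=\begin{bmatrix}1&1\\0&1\end{bmatrix}$: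 $$x_{nk}=\left(J_{21}J^{-1}_{11}+(nJ_{21}+J_{22})J^{-1}_{21}\right)x_1+\left(J_{21}J^{-1}_{12}+(nJ_{21}+J_{22})J^{-1}_{22}\right)x_0,$$ $$x_{nk+1}=\left(J_{11}J^{-1}_{11}+(nJ_{11}+J_{12})J^{-1}_{21}\right)x_1+\left(J_{11}J^{-1}_{12}+(nJ_{11}+J_{12})J^{-1}_{22}\right)x_0.$$ 3. Case $k$ even and $\operatorname{tr}C_k=-2$, with $\Lambda=\begin{bmatrix}-1&1\\0&-1\end{bmatrix}$: $$x_{nk}=(-1)^n\left(J_{21}J^{-1}_{11}+(-nJ_{21}+J_{22})J^{-1}_{21}\right)x_1+(-1)^n\left(J_{21}J^{-1}_{12}+(-nJ_{21}+J_{22})J^{-1}_{22}\right)x_0,$$ $$x_{nk+1}=(-1)^n\left(J_{11}J^{-1}_{11}+(-nJ_{11}+J_{12})J^{-1}_{21}\right)x_1+(-1)^n\left(J_{11}J^{-1}_{12}+(-nJ_{11}+J_{12})J^{-1}_{22}\right)x_0.$$ In all three cases, moreover, $$x_{nk+(i+2)}=a_i\,x_{nk+(i+1)}+x_{nk+i},\qquad i\in\{0,1,2,\ldots,k-3\}.$$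
   Context: $\mathbb{N}=\{0,1,2,\ldots\}$. A ''non-zero sequence'' means a sequence that is not identically zero; individual terms may vanish. The numbers $$\Phi_k^{\pm}=\frac12\left(\operatorname{tr}C_k\pm\sqrt{(\operatorname{tr}C_k)^2-4(-1)^k}\right)$$ are the eigenvalues (Floquet multipliers) of the monodromy matrix $C_k$, with a fixed choice of square root; note $\det C_k=(-1)^k$. The notation $J^{-1}_{ij}$ always means the $(i,j)$ entry of the inverse matrix $J^{-1}$, not the reciprocal of $J_{ij}$. The decomposition $C_k=J\Lambda J^{-1}$ with the displayed form of $\Lambda$ is part of the setting: $J$ is any invertible complex matrix realizing it. If $k\le 2$ the index set $\{0,\ldots,k-3\}$ is empty. *)

(* Defs.v *)
From mathcomp Require Import all_boot all_order all_algebra.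
From mathcomp Require Import reals complex.

Set Implicit Arguments.
Unset Strict Implicit.
Unset Printing Implicit Defensive.

Import Order.TTheory GRing.Theory Num.Theory.
Local Open Scope ring_scope.

(* Matrix entries are 0-based: the informal J_21 is [J 1 0], and so on. *)
Definition mx2 (K : nzRingType) (a b c d : K) : 'M[K]_2 :=
  \matrix_(i < 2, j < 2) nth 0 (nth [::] [:: [:: a; b]; [:: c; d]] i) j.

Definition transfer (K : nzRingType) (a : nat -> K) (i : nat) : 'M[K]_2 :=
  mx2 (a i) 1 1 0.

(* [rev_ord] puts the factor of index k-1 leftmost:
   A_(k-1) * A_(k-2) * ... * A_0. *)
Definition monodromy (K : nzRingType) (a : nat -> K) (k : nat) : 'M[K]_2 :=
  \prod_(i < k) transfer a (rev_ord i).

(* The Floquet multipliers are parameterized by the chosen square root [s] of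
   (tr C)^2 - 4(-1)^k, so that every choice of the root is covered. *)
Definition is_disc_root (K : fieldType) (a : nat -> K) (k : nat) (s : K) : Prop :=
  s ^+ 2 = (\tr (monodromy a k)) ^+ 2 - 4 * (-1) ^+ k.

Definition Phi_minus (K : fieldType) (a : nat -> K) (k : nat) (s : K) : K :=
  2^-1 * (\tr (monodromy a k) - s).

Definition Phi_plus (K : fieldType) (a : nat -> K) (k : nat) (s : K) : K :=
  2^-1 * (\tr (monodromy a k) + s).

Definition decomposes (K : fieldType) (C J L : 'M[K]_2) : Prop :=
  J \in unitmx /\ C = J *m L *m invmx J.

(* Main.v *)
Require Import Defs.
From mathcomp Require Import all_boot all_order all_algebra.
From mathcomp Require Import reals complex.
From mathcomp Require Import ring.

Set Implicit Arguments.
Unset Strict Implicit.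
Unset Printing Implicit Defensive.

Import Order.TTheory GRing.Theory Num.Theory.
Local Open Scope ring_scope.

(** The scalar recurrence of order two is a first-order linear system for the
    column (x_(m+1), x_m), with matrix [transfer a m] ([phase_step]).  By
    periodicity, following it over one period always applies the same matrix
    C, whichever period it is, so at time n k the column is C^n applied to
    (x_1, x_0) ([phase_periods]).  The decomposition C = J L J^-1 gives
    C^n = J L^n J^-1 ([decomposesX]), and L^n is explicit both for a diagonal
    L ([mx2_diagX]) and for a Jordan block ([mx2_jordanX]).  In the three
    cases L^n is upper triangular, so the closed forms all come from reading
    off the two coordinates of J L^n J^-1 (x_1, x_0) once
    ([orbit_at_periods]).  The recurrence inside a period is the original one,
    with the coefficient a_(nk+i) equal to a_i. *)

(** The newer term comes first, to match the companion form of [transfer]. *)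
Definition phase (K : nzRingType) (x : nat -> K) (m : nat) : 'cV[K]_2 :=
  \col_(i < 2) nth 0 [:: x m.+1; x m] i.

Lemma phase_step (K : nzRingType) (a x : nat -> K) (m : nat) :
  x (m + 2)%N = a m * x (m + 1)%N + x m ->
  phase x m.+1 = transfer a m *m phase x m.
Proof.
rewrite addn2 addn1 => xE; apply/matrixP=> i j.
rewrite !mxE big_ord_recl big_ord1 !mxE /=.
by case: i => [[|[|//]] ?] /=; rewrite ?mul1r ?mul0r ?addr0.
Qed.

Lemma monodromyS (K : nzRingType) (a : nat -> K) (k : nat) :
  monodromy a k.+1 = transfer a k *m monodromy a k.
Proof.
by rewrite /monodromy big_ord_recl /= subn1 /=; congr (_ * _).
Qed.

Lemma periodicM (T : Type) (a : nat -> T) (k : nat) :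
  (forall m, a (m + k)%N = a m) -> forall n i, a (n * k + i)%N = a i.
Proof.
by move=> aP; elim=> [|n IHn] i //; rewrite mulSn -addnA addnC aP IHn.
Qed.

(** Started at any multiple of the period, the system sees the same
    coefficients as when started at time 0. *)
Lemma phase_within_period (K : nzRingType) (a x : nat -> K) (k n j : nat) :
    (forall m, a (m + k)%N = a m) ->
    (forall m, x (m + 2)%N = a m * x (m + 1)%N + x m) ->
  phase x (n * k + j) = monodromy a j *m phase x (n * k).
Proof.
move=> a_per x_rec; elim: j => [|j IHj].
  by rewrite addn0 /monodromy big_ord0 mul1mx.
rewrite addnS (phase_step (x_rec _)) IHj mulmxA monodromyS.
by rewrite /transfer (periodicM a_per).
Qed.

Lemma phase_periods (K : nzRingType) (a x : nat -> K) (k n : nat) :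
    (forall m, a (m + k)%N = a m) ->
    (forall m, x (m + 2)%N = a m * x (m + 1)%N + x m) ->
  phase x (n * k) = monodromy a k ^+ n *m phase x 0.
Proof.
move=> a_per x_rec; elim: n => [|n IHn]; first by rewrite mul0n expr0 mul1mx.
by rewrite mulSn addnC (phase_within_period _ _ a_per x_rec) IHn mulmxA exprS.
Qed.

Lemma recurrence_within_period (K : nzRingType) (a x : nat -> K) (k n i : nat) :
    (forall m, a (m + k)%N = a m) ->
    (forall m, x (m + 2)%N = a m * x (m + 1)%N + x m) ->
  x (n * k + (i + 2))%N = a i * x (n * k + (i + 1))%N + x (n * k + i)%N.
Proof. by move=> a_per x_rec; rewrite !addnA x_rec (periodicM a_per). Qed.

Lemma decomposesX (K : fieldType) (C J L : 'M[K]_2) (n : nat) :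
  decomposes C J L -> C ^+ n = J *m L ^+ n *m invmx J.
Proof.
move=> [Ju CE]; elim: n => [|n IHn].
  by rewrite !expr0 -[J *m 1]/(J *m 1%:M) mulmx1 mulmxV.
by rewrite !exprS IHn CE -!mulmxE !mulmxA mulmxKV.
Qed.

Lemma mx2_mul (K : nzRingType) (a b c d a' b' c' d' : K) :
  mx2 a b c d * mx2 a' b' c' d'
  = mx2 (a * a' + b * c') (a * b' + b * d') (c * a' + d * c') (c * b' + d * d').
Proof.
apply/matrixP=> i j; rewrite !mxE big_ord_recl big_ord1 !mxE /=.
by case: i => [[|[|//]] ?]; case: j => [[|[|//]] ?].
Qed.

Lemma mx2_1 (K : nzRingType) : mx2 1 0 0 1 = 1 :> 'M[K]_2.
Proof.
by apply/matrixP=> i j; rewrite !mxE; case: i => [[|[|//]] ?]; case: j => [[|[|//]] ?].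
Qed.

Lemma mx2_diagX (K : nzRingType) (p q : K) (n : nat) :
  mx2 p 0 0 q ^+ n = mx2 (p ^+ n) 0 0 (q ^+ n).
Proof.
elim: n => [|n IHn]; first by rewrite !expr0 mx2_1.
by rewrite !exprS IHn mx2_mul !mul0r !mulr0 !addr0 !add0r.
Qed.

(** The nilpotent part of the block squares to zero, so only two terms of the
    binomial expansion survive.  The truncation of [n.-1] at n = 0 is harmless,
    since the factor [n%:R] vanishes there. *)
Lemma mx2_jordanX (K : comNzRingType) (l : K) (n : nat) :
  mx2 l 1 0 l ^+ n = mx2 (l ^+ n) (n%:R * l ^+ n.-1) 0 (l ^+ n).
Proof.
elim: n => [|n IHn]; first by rewrite !expr0 mul0r mx2_1.
rewrite exprS IHn mx2_mul; congr mx2; rewrite -?exprS /=; try ring.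
by case: n {IHn} => [|n] /=; rewrite ?exprS; ring.
Qed.

(** The common form of the three cases: only the powers of the normal form L
    differ between them. *)
Lemma orbit_at_periods (K : fieldType) (a x : nat -> K) (k n : nat)
    (J L : 'M[K]_2) (p r q : K) :
    (forall m, a (m + k)%N = a m) ->
    (forall m, x (m + 2)%N = a m * x (m + 1)%N + x m) ->
    decomposes (monodromy a k) J L -> L ^+ n = mx2 p r 0 q ->
  let V := invmx J in
  let u := V 0 0 * x 1%N + V 0 1 * x 0%N in
  let v := V 1 0 * x 1%N + V 1 1 * x 0%N in
  x (n * k)%N = J 1 0 * (p * u + r * v) + J 1 1 * (q * v) /\
  x (n * k + 1)%N = J 0 0 * (p * u + r * v) + J 0 1 * (q * v).
Proof.
move=> a_per x_rec dec Ln V u v.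
have orbitE : phase x (n * k) = J *m (mx2 p r 0 q *m (V *m phase x 0)).
  by rewrite (phase_periods n a_per x_rec) (decomposesX n dec) Ln !mulmxA.
have coordE i : (phase x (n * k)) i 0
    = J i 0 * (p * u + r * v) + J i 1 * (q * v).
  have ord1E : lift ord0 ord0 = 1 :> 'I_2 by apply/val_inj.
  rewrite orbitE !(mxE, big_ord_recl, big_ord0) /= ?ord1E !addr0 mul0r add0r.
  by [].
by split; [rewrite -coordE mxE | rewrite addn1 -coordE mxE].
Qed.

Theorem corollary3p5 (R : realType) (k : nat) (k_gt0 : (0 < k)%N)
    (a : nat -> R[i]) (a_neq0 : exists m : nat, a m != 0)
    (a_per : forall m : nat, a (m + k)%N = a m)
    (x0 x1 : R[i]) (x : nat -> R[i])
    (x_init0 : x 0%N = x0) (x_init1 : x 1%N = x1)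
    (x_rec : forall m : nat, x (m + 2)%N = a m * x (m + 1)%N + x m)
    (s : R[i]) (s_root : is_disc_root a k s)
    (J : 'M[R[i]]_2) (n : nat) :
  let C := monodromy a k in
  let V := invmx J in
  [/\ (odd k \/ ~~ odd k /\ `|\tr C| != 2) ->
      decomposes C J (mx2 (Phi_minus a k s) 0 0 (Phi_plus a k s)) ->
      [/\ x (n * k)%N =
            J 1 0 * (V 0 0 * x1 + V 0 1 * x0) * Phi_minus a k s ^+ n
            + J 1 1 * (V 1 0 * x1 + V 1 1 * x0) * Phi_plus a k s ^+ n,
          x (n * k + 1)%N =
            J 0 0 * (V 0 0 * x1 + V 0 1 * x0) * Phi_minus a k s ^+ n
            + J 0 1 * (V 1 0 * x1 + V 1 1 * x0) * Phi_plus a k s ^+ n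
        & forall i : nat, (i + 3 <= k)%N ->
            x (n * k + (i + 2))%N
            = a i * x (n * k + (i + 1))%N + x (n * k + i)%N],
      ~~ odd k -> \tr C = 2 -> decomposes C J (mx2 1 1 0 1) ->
      [/\ x (n * k)%N =
            (J 1 0 * V 0 0 + (n%:R * J 1 0 + J 1 1) * V 1 0) * x1
            + (J 1 0 * V 0 1 + (n%:R * J 1 0 + J 1 1) * V 1 1) * x0,
          x (n * k + 1)%N =
            (J 0 0 * V 0 0 + (n%:R * J 0 0 + J 0 1) * V 1 0) * x1
            + (J 0 0 * V 0 1 + (n%:R * J 0 0 + J 0 1) * V 1 1) * x0
        & forall i : nat, (i + 3 <= k)%N ->
            x (n * k + (i + 2))%N
            = a i * x (n * k + (i + 1))%N + x (n * k + i)%N]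
    & ~~ odd k -> \tr C = - 2 -> decomposes C J (mx2 (- 1) 1 0 (- 1)) ->
      [/\ x (n * k)%N =
            (-1) ^+ n
              * (J 1 0 * V 0 0 + (- n%:R * J 1 0 + J 1 1) * V 1 0) * x1
            + (-1) ^+ n
              * (J 1 0 * V 0 1 + (- n%:R * J 1 0 + J 1 1) * V 1 1) * x0,
          x (n * k + 1)%N =
            (-1) ^+ n
              * (J 0 0 * V 0 0 + (- n%:R * J 0 0 + J 0 1) * V 1 0) * x1
            + (-1) ^+ n
              * (J 0 0 * V 0 1 + (- n%:R * J 0 0 + J 0 1) * V 1 1) * x0
        & forall i : nat, (i + 3 <= k)%N ->
            x (n * k + (i + 2))%N
            = a i * x (n * k + (i + 1))%N + x (n * k + i)%N]].
Proof.
move=> C V; subst x0 x1.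
have within i (_ : (i + 3 <= k)%N) := recurrence_within_period n i a_per x_rec.
split.
- move=> _ dec.
  have [-> ->] := orbit_at_periods a_per x_rec dec (mx2_diagX _ _ n).
  by split=> //; rewrite -/V; ring.
- move=> _ _ dec.
  have [-> ->] := orbit_at_periods a_per x_rec dec (mx2_jordanX _ n).
  by split=> //; rewrite -/V !expr1n; ring.
- move=> _ _ dec.
  have [-> ->] := orbit_at_periods a_per x_rec dec (mx2_jordanX _ n).
  (* As -1 is its own inverse, (-1)^(n-1) is - (-1)^n. *)
  have -> : n%:R * (-1) ^+ n.-1 = - n%:R * (-1) ^+ n :> R[i].
    by case: (n) => [|m]; rewrite ?oppr0 ?mul0r //= exprS mulN1r mulrNN.
  by split=> //; rewrite -/V; ring.
Qed.
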